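(* Let $f,g\colon X\to Y$ be continuous maps and let $u_0,\dots,u_k\in\mathcal{J}(f,g)$ be cohomology classes with $u_0\smile\cdots\smile u_k\neq 0$. Then $\mathrm{D}(f,g)\geq \sum_{j=0}^k \mathrm{hw}_{f,g}(u_j)$.
   Context: $R$ is a commutative ring with unit and $H^*(-;R)$ is cohomology with coefficients in $R$; $\mathcal{J}(f,g)\subset H^*(X;R)$ is the image of $f^*-g^*\colon H^*(Y;R)\to H^*(X;R)$. For continuous maps $f,g\colon X\to Y$, the homotopic distance $\mathrm{D}(f,g)$ is the least integer $n\geq 0$ such that there is an open cover $\{U_0,\dots,U_n\}$ of $X$ with $f|_{U_j}\simeq g|_{U_j}$ for all $j$ ($\infty$ if none exists). Homotopy weight: for $u\in H^*(X;R)$, $\mathrm{hw}_{f,g}(u)=k+1$ where $k$ is the greatest integer such that for every topological space $A$ and every continuous map $\phi\colon A\to X$ with $\mathrm{D}(f\circ\phi,g\circ\phi)\leq k$ one has $\phi^*u=0\in H^*(A;R)$; and $\mathrm{hw}_{f,g}(0)=\infty$. *)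

(* Defs.v *)
From HB Require Import structures.
From mathcomp Require Import all_boot all_order all_algebra.
From mathcomp Require Import all_classical all_reals all_analysis.
From mathcomp Require Import Rstruct Rstruct_topology.

Unset Implicit Arguments.
Unset Strict Implicit.
Unset Printing Implicit Defensive.

Import Order.TTheory GRing.Theory Num.Theory.
Local Open Scope classical_set_scope.
Local Open Scope ring_scope.

Definition Rr : realType := Rdefinitions.R.

Definition Delta (n : nat) : set 'rV[Rr]_n.+1 :=
  [set t | (forall i, 0 <= t ord0 i) /\ \sum_i t ord0 i = 1].
Arguments Delta n : clear implicits.

Definition simplex (n : nat) : topologicalType := set_type (Delta n).

(* affine map sending the vertex e_i to the vertex e_(a i) *)
Definition affmap {m n} (a : 'I_m.+1 -> 'I_n.+1) (t : 'rV[Rr]_m.+1)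
  : 'rV[Rr]_n.+1 := \row_j \sum_(i | a i == j) t ord0 i.

Lemma affmap_Delta m n (a : 'I_m.+1 -> 'I_n.+1) t :
  Delta m t -> Delta n (affmap a t).
Proof.
move=> [t0 t1]; split.
  by move=> j; rewrite mxE; apply: sumr_ge0 => i _; exact: t0.
under eq_bigr do rewrite mxE.
rewrite (exchange_big_dep xpredT) //= -t1; apply: eq_bigr => i _.
by rewrite (big_pred1 (a i)) // => j; rewrite eq_sym.
Qed.

Definition simp_map {m n} (a : 'I_m.+1 -> 'I_n.+1) : simplex m -> simplex n :=
  fun t => @exist _ (fun x => x \in Delta n) (affmap a (set_val t))
    (mem_set (affmap_Delta m n a (set_val t) (set_mem (svalP t)))).

Definition face {n} (i : 'I_n.+2) : simplex n -> simplex n.+1 :=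
  simp_map (lift i).

(* front p-face and back (n-p)-face of Delta^n (for p <= n) *)
Definition frontmap (p n : nat) : simplex p -> simplex n :=
  simp_map (fun i : 'I_p.+1 => inord i).
Definition backmap p n : simplex (n - p) -> simplex n :=
  simp_map (fun i : 'I_(n - p).+1 => inord (p + i)).

(* A singular n-simplex is a continuous map simplex n -> X.  For       *)
(* convenience cochains are defined on all maps simplex n -> X, and    *)
(* every cohomological condition is only required on continuous        *)
(* simplices, so values on non-continuous maps are irrelevant.         *)

Section Cochains.
Variable R : comPzRingType.

Definition cochain (X : topologicalType) (n : nat) := (simplex n -> X) -> R.

Definition tcochain (X : topologicalType) := forall n : nat, cochain X n.

Definition delta {X : topologicalType} {n} (c : cochain X n) : cochain X n.+1 :=
  fun s => \sum_(i < n.+2) (-1) ^+ i * c (s \o face i).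

Definition tdelta {X : topologicalType} (c : tcochain X) : tcochain X :=
  fun n => match n return cochain X n with
           | 0 => fun _ => 0
           | m.+1 => delta (c m)
           end.

Definition tsub {X : topologicalType} (a b : tcochain X) : tcochain X :=
  fun n s => a n s - b n s.

Definition cocycle {X : topologicalType} (c : tcochain X) : Prop :=
  forall n (s : simplex n.+1 -> X), continuous s -> tdelta c n.+1 s = 0.

Definition coboundary {X : topologicalType} (c : tcochain X) : Prop :=
  exists b : tcochain X,
    forall n (s : simplex n -> X), continuous s -> c n s = tdelta b n s.

(* finitely many nonzero degrees: an element of the direct sum *)
Definition finsupp {X : topologicalType} (c : tcochain X) : Prop :=
  exists N, forall n (s : simplex n -> X), (N <= n)%N -> c n s = 0.

(* representatives of classes of H^*(X;R) = (+)_n H^n(X;R) *)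
Definition is_class {X : topologicalType} (c : tcochain X) : Prop :=
  cocycle c /\ finsupp c.

Definition cohomologous {X : topologicalType} (a b : tcochain X) : Prop :=
  coboundary (tsub a b).

Definition cup {X : topologicalType} (a b : tcochain X) : tcochain X :=
  fun n s => \sum_(p < n.+1)
      a p (s \o frontmap p n) * b (n - p)%N (s \o backmap p n).

Fixpoint cupn {X : topologicalType} (u : nat -> tcochain X) (k : nat)
  : tcochain X :=
  match k with
  | 0 => u 0%N
  | k'.+1 => cup (cupn u k') (u k)
  end.

Definition pb {A X : topologicalType} (phi : A -> X) (c : tcochain X)
  : tcochain A := fun n s => c n (phi \o s).

Definition in_J {X Y : topologicalType} (f g : X -> Y) (u : tcochain X)
  : Prop :=
  exists v : tcochain Y, is_class v /\ cohomologous u (tsub (pb f v) (pb g v)).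

End Cochains.

Arguments delta {R X n}.
Arguments tdelta {R X}.
Arguments tsub {R X}.
Arguments cocycle {R X}.
Arguments coboundary {R X}.
Arguments finsupp {R X}.
Arguments is_class {R X}.
Arguments cohomologous {R X}.
Arguments cup {R X}.
Arguments cupn {R X}.
Arguments pb {R A X}.
Arguments in_J {R X Y}.

Definition homotopic_on {X Y : topologicalType} (U : set X) (f g : X -> Y)
  : Prop :=
  exists H : X * Rr -> Y,
    {within U `*` [set t : Rr | 0 <= t <= 1], continuous H} /\
    forall x, U x -> H (x, 0) = f x /\ H (x, 1) = g x.

Definition D_cover {X Y : topologicalType} (f g : X -> Y) (n : nat) : Prop :=
  exists U : 'I_n.+1 -> set X,
    (forall j, open (U j)) /\ \bigcup_j U j = setT /\
    (forall j, homotopic_on (U j) f g).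

(* homotopic distance, in the extended reals (+oo if no cover exists) *)
Definition Dist {X Y : topologicalType} (f g : X -> Y) : \bar Rr :=
  ereal_inf [set ((n%:R : Rr)%:E) | n in D_cover f g].

Definition hw_prop {R : comPzRingType} {X Y : topologicalType} (f g : X -> Y)
  (u : tcochain R X) (k : nat) : Prop :=
  forall (A : topologicalType) (phi : A -> X), continuous phi ->
    (Dist (f \o phi) (g \o phi) <= (k%:R : Rr)%:E)%E ->
    coboundary (pb phi u).

Definition hw {R : comPzRingType} {X Y : topologicalType} (f g : X -> Y)
  (u : tcochain R X) : \bar Rr :=
  if pselect (coboundary u) then +oo%E
  else ereal_sup ([set 0%E] `|`
                  [set ((k.+1%:R : Rr)%:E) | k in hw_prop f g u]).
(* k ranges over integers; k = -1 always qualifies vacuously (D >= 0),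
   which is the 0 contribution; for k >= 0 we use k : nat. *)

(* Main.v *)
(* Let U_0, ..., U_n be an open cover of X over which f and g are homotopic, and
   suppose that the homotopy weights of the u_j add up to more than n.  Then the
   U_i can be distributed into blocks, at most hw(u_j) of them in the j-th one.
   Over the union W_j of the j-th block the distance of f and g is less than
   hw(u_j), so that u_j restricts to zero on W_j.  As the W_j cover X, the product
   of the u_j vanishes: u_j is represented by a cocycle that is zero on all
   simplices inside W_j, the cup product of these representatives is zero on all
   simplices that lie in some W_j, and a cocycle with this property is a
   coboundary by barycentric subdivision. *)
Require Import Defs.
From HB Require Import structures.
From mathcomp Require Import all_boot all_order all_algebra.
From mathcomp Require Import all_classical all_reals all_analysis.
From mathcomp Require Import Rstruct Rstruct_topology.
From mathcomp Require Import ring zify.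

Import Order.TTheory GRing.Theory Num.Theory.
Import numFieldNormedType.Exports.
Local Open Scope ring_scope.

(** * Ordered cochains on sequences of points *)

Section OrderedCochains.
Context {R : comPzRingType} {V : Type}.
Implicit Types (phi psi : seq V -> R) (v w : seq V).

Definition omit i w : seq V := take i w ++ drop i.+1 w.

Lemma size_omit i w : (i < size w)%N -> size (omit i w) = (size w).-1.
Proof. by move=> iw; rewrite size_cat size_drop size_takel 1?ltnW//; lia. Qed.

Lemma omit_sub (Q : V -> Prop) i w :
  (forall x, List.In x w -> Q x) -> forall x, List.In x (omit i w) -> Q x.
Proof.
elim: w i => [|y w IH] [|i] Qw x.
- by move=> /= [].
- by move=> /= [].
- by rewrite /omit /= drop0 => xw; apply: Qw; right.
- move=> /= [<-|xw]; first by apply: Qw; left.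
  by apply: (IH i) => // z zw; apply: Qw; right.
Qed.

(** Splitting off the face opposite the first vertex lets the identities below be proved by
    induction on the sequence, with the cochain generalized. The value on a one-point sequence is
    [phi [::]]: the complex is augmented. *)
Fixpoint odelta phi w : R :=
  if w is x :: w' then phi w' - odelta (fun z => phi (x :: z)) w' else 0.

Lemma odeltaE phi w :
  odelta phi w = \sum_(i < size w) (-1) ^+ i * phi (omit i w).
Proof.
elim: w phi => [|x w IH] phi /=; first by rewrite big_ord0.
rewrite big_ord_recl /= expr0 mul1r /omit /= drop0; congr (_ + _).
rewrite IH -sumrN; apply: eq_bigr => i _.
by rewrite /bump /= add1n exprS mulN1r mulNr.
Qed.

Lemma eq_odelta phi psi w :
  (forall i, (i < size w)%N -> phi (omit i w) = psi (omit i w)) ->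
  odelta phi w = odelta psi w.
Proof.
by move=> e; rewrite !odeltaE; apply: eq_bigr => i _; rewrite e.
Qed.

Lemma odeltaB phi psi w :
  odelta (fun z => phi z - psi z) w = odelta phi w - odelta psi w.
Proof.
by rewrite !odeltaE -sumrB; apply: eq_bigr => i _; rewrite mulrBr.
Qed.

Lemma odeltaD phi psi w :
  odelta (fun z => phi z + psi z) w = odelta phi w + odelta psi w.
Proof.
by rewrite !odeltaE -big_split; apply: eq_bigr => i _; rewrite mulrDr.
Qed.

Lemma odeltaZ a phi w : odelta (fun z => a * phi z) w = a * odelta phi w.
Proof.
by rewrite !odeltaE mulr_sumr; apply: eq_bigr => i _; rewrite mulrCA.
Qed.

Lemma odelta_sum n (phi : nat -> seq V -> R) w :
  odelta (fun z => \sum_(i < n) phi i z) w = \sum_(i < n) odelta (phi i) w.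
Proof.
rewrite odeltaE; under [RHS]eq_bigr do rewrite odeltaE.
rewrite exchange_big; apply: eq_bigr => i _; exact: mulr_sumr.
Qed.

Lemma odelta_odelta phi w : odelta (odelta phi) w = 0.
Proof.
elim: w phi => //= x w IH phi.
by rewrite odeltaB IH subr0 subrr.
Qed.

(** The Alexander-Whitney product; front and back faces share one vertex. *)
Fixpoint ocup phi psi w : R :=
  if w is x :: w' then
    phi [:: x] * psi w + ocup (fun z => phi (x :: z)) psi w'
  else 0.

Lemma ocupE phi psi w :
  ocup phi psi w =
  \sum_(p < size w) phi (take p.+1 w) * psi (drop p w).
Proof.
elim: w phi => [|x w IH] phi /=; first by rewrite big_ord0.
by rewrite big_ord_recl /= take0 IH.
Qed.

Lemma eq_ocup phi phi' psi psi' w : phi =1 phi' -> psi =1 psi' ->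
  ocup phi psi w = ocup phi' psi' w.
Proof.
by move=> e1 e2; rewrite !ocupE; apply: eq_bigr => i _; rewrite e1 e2.
Qed.

Lemma ocupBl phi phi' psi w :
  ocup (fun z => phi z - phi' z) psi w = ocup phi psi w - ocup phi' psi w.
Proof.
by rewrite !ocupE -sumrB; apply: eq_bigr => i _; rewrite mulrBl.
Qed.

Lemma ocupBr phi psi psi' w :
  ocup phi (fun z => psi z - psi' z) w = ocup phi psi w - ocup phi psi' w.
Proof.
by rewrite !ocupE -sumrB; apply: eq_bigr => i _; rewrite mulrBr.
Qed.

Lemma ocupNl phi psi w : ocup (fun z => - phi z) psi w = - ocup phi psi w.
Proof.
by rewrite !ocupE -sumrN; apply: eq_bigr => i _; rewrite mulNr.
Qed.

Lemma ocup0l phi psi w : phi =1 (fun=> 0) -> ocup phi psi w = 0.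
Proof. by move=> e; rewrite ocupE big1 // => i _; rewrite e mul0r. Qed.

Lemma ocup0r phi psi w : psi =1 (fun=> 0) -> ocup phi psi w = 0.
Proof. by move=> e; rewrite ocupE big1 // => i _; rewrite e mulr0. Qed.

(** A $q$-simplex has $q+1$ vertices, so [(size w).+1] has the parity of its degree. *)
Definition osign phi w : R := (-1) ^+ (size w).+1 * phi w.

(* The complex is augmented, whence the two terms in which the empty
   sequence occurs. *)
Lemma ocup_Leibniz phi psi w :
  ocup (odelta phi) psi w + ocup (osign phi) (odelta psi) w
    + (-1) ^+ size w * phi w * psi [::]
  = odelta (ocup phi psi) w + phi [::] * psi w.
Proof.
elim: w phi => [|x w IH] phi /=; first by rewrite expr0 mul1r !add0r.
rewrite odeltaD odeltaZ subr0 ocupBl.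
have -> : ocup (fun z => osign phi (x :: z)) (odelta psi) w
        = - ocup (osign (fun z => phi (x :: z))) (odelta psi) w.
  rewrite -ocupNl; apply: eq_ocup => // z.
  by rewrite /osign /= [in LHS]exprS mulN1r mulNr.
rewrite {1}/osign /= sqrrN expr1n mul1r.
have := IH (fun z => phi (x :: z)); rewrite exprS.
set A := ocup _ _ w; set B := ocup _ _ w; set C := ocup _ _ w.
set D := odelta _ w; set E := odelta _ w; set s := (-1) ^+ _.
by move/esym/(canRL (addrK _)) ->; ring.
Qed.
End OrderedCochains.

(** * Barycentric subdivision of ordered cochains *)

Section Subdivision.
Context {R : comPzRingType} {V : Type} (b : seq V -> V).
Implicit Types (phi psi : seq V -> R) (v w : seq V).

(* [osd phi v] is the value of [phi] on the subdivision [sd v] of the simplex [v],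
   where [sd v] is the cone with apex [b v] over [sd] of the boundary of [v]; [oht]
   is dual in the same way to the chain homotopy from the identity to [sd].  All
   identities hold for an arbitrary choice [b] of the apices. *)
Fixpoint osd_rec n phi v : R :=
  if n is n'.+1 then odelta (osd_rec n' (fun z => phi (b v :: z))) v
  else phi [::].

Definition osd phi v := osd_rec (size v) phi v.

Fixpoint oht_rec n phi v : R :=
  if n is n'.+1 then
    phi (b v :: v) - odelta (oht_rec n' (fun z => phi (b v :: z))) v
  else 0.

Definition oht phi v := oht_rec (size v) phi v.

Lemma osdE phi v : v <> [::] ->
  osd phi v = odelta (osd (fun z => phi (b v :: z))) v.
Proof.
move=> v0; rewrite {1}/osd; have -> : size v = (size v).-1.+1 by case: v v0.
rewrite [LHS]/=.
by apply: eq_odelta => i iv; rewrite /osd size_omit.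
Qed.

Lemma ohtE phi v : v <> [::] ->
  oht phi v = phi (b v :: v) - odelta (oht (fun z => phi (b v :: z))) v.
Proof.
move=> v0; rewrite {1}/oht; have -> : size v = (size v).-1.+1 by case: v v0.
rewrite [LHS]/=; congr (_ - _).
by apply: eq_odelta => i iv; rewrite /oht size_omit.
Qed.

(** The form of induction that fits [osd] and [oht], which recurse through all faces. *)
Lemma seq_omit_ind (P : seq V -> Prop) :
  P [::] ->
  (forall v, v <> [::] -> (forall i, (i < size v)%N -> P (omit i v)) -> P v) ->
  forall v, P v.
Proof.
move=> P0 PS v; move: {2}(size v) (leqnn (size v)) => n.
elim: n v => [|n IH] [|x v] // vn; apply: PS => // i iv.
by apply: IH; rewrite size_omit.
Qed.

Lemma osdB phi psi v : osd (fun z => phi z - psi z) v = osd phi v - osd psi v.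
Proof.
elim/seq_omit_ind: v phi psi => // v v0 IH phi psi.
rewrite !osdE // -odeltaB; apply: eq_odelta => i iv; exact: IH.
Qed.

Lemma ohtB phi psi v : oht (fun z => phi z - psi z) v = oht phi v - oht psi v.
Proof.
elim/seq_omit_ind: v phi psi => [|v v0 IH] phi psi.
  by rewrite /oht /= subrr.
rewrite !ohtE // (_ : odelta _ v = odelta (oht (fun z => phi (b v :: z))) v -
  odelta (oht (fun z => psi (b v :: z))) v); first by ring.
by rewrite -odeltaB; apply: eq_odelta => i iv; exact: IH.
Qed.

(** On a cone, [odelta phi] is [phi] on the base minus the coboundary of [z => phi (b v :: z)]; by
    induction the second part contributes a double coboundary, hence 0. *)
Lemma osd_odelta phi v : osd (odelta phi) v = odelta (osd phi) v.
Proof.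
elim/seq_omit_ind: v phi => // v v0 IH phi; rewrite osdE //.
rewrite -[RHS]subr0 -(odelta_odelta (osd (fun z => phi (b v :: z))) v).
rewrite -odeltaB; apply: eq_odelta => i iv /=.
by rewrite osdB IH.
Qed.

(** The cone computation of [osd_odelta] again; the double coboundary that drops out is now that of
    [oht]. *)
Lemma oht_odelta phi v :
  oht (odelta phi) v = phi v - osd phi v - odelta (oht phi) v.
Proof.
elim/seq_omit_ind: v phi => [|v v0 IH] phi.
  by rewrite /oht /osd /= subrr subr0.
rewrite ohtE //= osdE //.
set pb := fun z => phi (b v :: z).
have -> : odelta (oht (fun z => phi z - odelta pb z)) v =
    odelta (oht phi) v - odelta pb v + odelta (osd pb) v.
  rewrite -odeltaB -odeltaD -[RHS]addr0 -(odelta_odelta (oht pb) v) -odeltaD.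
  apply: eq_odelta => i iv; rewrite ohtB IH //=. ring.
ring.
Qed.

Lemma iter_osdB phi psi n v :
  iter n osd (fun z => phi z - psi z) v = iter n osd phi v - iter n osd psi v.
Proof.
elim: n v => //= n IH v; rewrite -osdB.
by congr (osd _ v); apply/funext => z; rewrite IH.
Qed.

Lemma iter_osd_odelta phi n v :
  iter n osd (odelta phi) v = odelta (iter n osd phi) v.
Proof.
elim: n v => //= n IH v; rewrite -osd_odelta.
by congr (osd _ v); apply/funext => z; rewrite IH.
Qed.

(** For a cocycle the homotopy formula reads [phi z - osd phi z = odelta (oht phi) z]; it is
    subdivided [i] times and summed over [i]. *)
Lemma osd_telescope phi n v : (forall w, odelta phi w = 0) ->
  phi v - iter n osd phi v =
  odelta (fun z => \sum_(i < n) iter i osd (oht phi) z) v.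
Proof.
move=> dphi; rewrite odelta_sum.
have step i : iter i osd phi v - iter i.+1 osd phi v
    = odelta (iter i osd (oht phi)) v.
  rewrite iterSr -iter_osdB -iter_osd_odelta; congr (iter i osd _ v).
  apply/funext => z; have := oht_odelta phi z.
  rewrite (_ : oht (odelta phi) z = 0) => [/esym/subr0_eq //|].
  (* The zero cochain is written as a difference, so that additivity of [oht] yields 0. *)
  rewrite (_ : odelta phi = fun z => phi z - phi z) ?ohtB ?subrr //.
  by apply/funext => w; rewrite dphi subrr.
elim: n => [|n IH]; first by rewrite big_ord0 subrr.
by rewrite big_ord_recr /= -step -IH /=; ring.
Qed.

(* [sdsub v w]: [w] is one of the simplices of the subdivision of [v]. *)
Inductive sdsub : seq V -> seq V -> Prop :=
| sdsub_nil : sdsub [::] [::]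
| sdsub_cons v i w : (i < size v)%N -> sdsub (omit i v) w ->
    sdsub v (b v :: w).

Lemma osd_vanish phi v : (forall w, sdsub v w -> phi w = 0) -> osd phi v = 0.
Proof.
elim/seq_omit_ind: v phi => [|v v0 IH] phi phi0.
  by apply: phi0; exact: sdsub_nil.
rewrite osdE // odeltaE big1 // => i _; rewrite IH ?mulr0 // => w sw.
by apply: phi0; apply: (sdsub_cons _ i).
Qed.

Lemma sdsub_size v w : sdsub v w -> size w = size v.
Proof.
by elim=> // {}v i {}w iv _ /= ->; rewrite size_omit // prednK //; case: size iv.
Qed.

Section ClosedPredicate.
Context (Q : V -> Prop).
Hypothesis Qb : forall v, v <> [::] -> (forall x, List.In x v -> Q x) -> Q (b v).

(** Applied with [Q] a closed ball, which is stable under barycenters. *)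
Lemma sdsub_closed v w : sdsub v w ->
  (forall x, List.In x v -> Q x) -> forall x, List.In x w -> Q x.
Proof.
elim=> // {}v i {}w iv _ IH Qv x /= [<-|].
  by apply: Qb => // v0; rewrite v0 in iv.
by apply: IH; exact: omit_sub.
Qed.

Lemma oht_vanish phi v :
  (forall w, (forall x, List.In x w -> Q x) -> phi w = 0) ->
  (forall x, List.In x v -> Q x) -> oht phi v = 0.
Proof.
elim/seq_omit_ind: v phi => // v v0 IH phi phi0 Qv.
rewrite ohtE // phi0; last by move=> x /= [<-|]; [exact: Qb|exact: Qv].
rewrite odeltaE big1 ?subr0 // => i _; rewrite IH ?mulr0 //.
  by move=> w Qw; apply: phi0 => x /= [<-|]; [exact: Qb|exact: Qw].
exact: omit_sub.
Qed.

End ClosedPredicate.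
End Subdivision.

(** * Naturality of subdivision *)

Lemma odelta_map {R : comPzRingType} {V W : Type} (F : V -> W)
    (phi : seq W -> R) v : odelta (fun z => phi (map F z)) v = odelta phi (map F v).
Proof. by elim: v phi => //= x v IH phi; rewrite -(IH (fun z => phi (F x :: z))). Qed.

Section Naturality.
Context {R : comPzRingType} {V W : Type} (b : seq V -> V) (b' : seq W -> W).
Context (F : V -> W).
Hypothesis Fb : forall v, v <> [::] -> F (b v) = b' (map F v).

(** Later [F] is an affine simplex and [b], [b'] take barycenters. [Fb] concerns non-empty sequences
    because [bary [::]] is a mere default value. *)
Lemma osd_map (phi : seq W -> R) v :
  osd b (fun z => phi (map F z)) v = osd b' phi (map F v).
Proof.
elim/(@seq_omit_ind V): v phi => // v v0 IH phi.
rewrite osdE // [RHS]osdE -?Fb //; last by case: v v0 {IH}.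
rewrite -odelta_map; apply: eq_odelta => i iv /=.
by rewrite -(IH i iv (fun z => phi (F (b v) :: z))).
Qed.

Lemma oht_map (phi : seq W -> R) v :
  oht b (fun z => phi (map F z)) v = oht b' phi (map F v).
Proof.
elim/(@seq_omit_ind V): v phi => // v v0 IH phi.
rewrite ohtE // [RHS]ohtE -?Fb //; last by case: v v0 {IH}.
congr (_ - _); rewrite -odelta_map; apply: eq_odelta => i iv /=.
by rewrite -(IH i iv (fun z => phi (F (b v) :: z))).
Qed.

Lemma iter_osd_map n (phi : seq W -> R) v :
  iter n (osd b) (fun z => phi (map F z)) v = iter n (osd b') phi (map F v).
Proof.
elim: n v => //= n IH v; rewrite -osd_map.
by congr (osd b _ v); apply/funext => z; rewrite IH.
Qed.

End Naturality.

(** * Affine simplices *)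

Section Simplex.

Definition spoint {n} (t : 'rV[Rr]_n.+1) (h : Delta n t) : simplex n :=
  @exist _ (fun x => x \in Delta n) t (mem_set h).

Lemma simplex_inj {n} (s t : simplex n) : set_val s = set_val t -> s = t.
Proof. exact: val_inj. Qed.

Lemma simplex_ge0 {n} (t : simplex n) i : 0 <= set_val t ord0 i.
Proof. by have [] := set_valP t. Qed.

Lemma simplex_sum1 {n} (t : simplex n) : \sum_i set_val t ord0 i = 1.
Proof. by have [] := set_valP t. Qed.

Lemma vertex_Delta n (i : 'I_n.+1) : Delta n (delta_mx ord0 i).
Proof.
split=> [j|]; first by rewrite mxE ler0n.
rewrite (bigD1 i) //= mxE !eqxx big1 ?addr0 // => j ji.
by rewrite mxE (negbTE ji) andbF.
Qed.

Definition vertex {n} (i : 'I_n.+1) : simplex n := spoint _ (vertex_Delta n i).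

Lemma center_Delta n : Delta n (const_mx (n.+1%:R^-1)).
Proof.
split=> [j|]; first by rewrite mxE invr_ge0 ler0n.
under eq_bigr do rewrite mxE.
by rewrite sumr_const card_ord -[LHS]mulr_natr mulVf // pnatr_eq0.
Qed.

Definition center n : simplex n := spoint _ (center_Delta n).

Lemma aff_Delta n q (w : seq (simplex n)) (t : simplex q) :
  Delta n (\sum_(i < q.+1)
    set_val t ord0 i *: set_val (nth (vertex ord0) w i)).
Proof.
split=> [j|].
  rewrite summxE; apply: sumr_ge0 => i _.
  by rewrite mxE mulr_ge0 ?simplex_ge0.
under eq_bigr do rewrite summxE.
rewrite exchange_big /= -[RHS](simplex_sum1 t); apply: eq_bigr => i _.
by under eq_bigr do rewrite mxE; rewrite -mulr_sumr simplex_sum1 mulr1.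
Qed.

(** Missing vertices default to [vertex ord0], which makes [aff] total. *)
Definition aff {n} q (w : seq (simplex n)) (t : simplex q) : simplex n :=
  spoint _ (aff_Delta n q w t).

Lemma affE {n} q (w : seq (simplex n)) (t : simplex q) :
  set_val (aff q w t) =
  \sum_(i < q.+1) set_val t ord0 i *: set_val (nth (vertex ord0) w i).
Proof. by []. Qed.

Definition bary {n} (v : seq (simplex n)) : simplex n :=
  aff (size v).-1 v (center _).

Definition vertices n : seq (simplex n) := [seq vertex i | i <- enum 'I_n.+1].

Lemma size_vertices n : size (vertices n) = n.+1.
Proof. by rewrite size_map size_enum_ord. Qed.

Lemma nth_vertices n x0 (i : 'I_n.+1) : nth x0 (vertices n) i = vertex i.
Proof.
by rewrite (nth_map ord0) ?size_enum_ord ?ltn_ord // nth_ord_enum.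
Qed.

Lemma aff_vertices n : aff n (vertices n) = id.
Proof.
apply/funext => t; apply: simplex_inj; rewrite affE.
under eq_bigr do rewrite nth_vertices.
by rewrite [RHS]row_sum_delta.
Qed.

Lemma aff_map {n} q (w : seq (simplex n)) p (v : seq (simplex q)) :
  size v = p.+1 -> aff p (map (aff q w) v) = aff q w \o aff p v.
Proof.
move=> sv; apply/funext => t; apply: simplex_inj; rewrite [RHS]affE affE.
rewrite (eq_bigr (fun i : 'I_p.+1 => \sum_(j < q.+1) set_val t ord0 i *:
  (set_val (nth (vertex ord0) v i) ord0 j *: set_val (nth (vertex ord0) w j)))); last first.
  move=> i _; rewrite (nth_map (vertex ord0)) ?sv // affE scaler_sumr.
  by [].
rewrite exchange_big /=; apply: eq_bigr => j _.
rewrite affE summxE scaler_suml; apply: eq_bigr => i _.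
by rewrite scalerA mxE.
Qed.

Lemma bary_map {n} q (w : seq (simplex n)) (v : seq (simplex q)) :
  v <> [::] -> aff q w (bary v) = bary (map (aff q w) v).
Proof.
move=> v0; rewrite /bary aff_map /=; first by rewrite size_map.
by rewrite size_map; case: v v0.
Qed.

(** The sum over the vertices is regrouped along the fibers of [a]. Faces, front faces and back
    faces are all of this form. *)
Lemma aff_simp_map {n} p q (w w' : seq (simplex n)) (a : 'I_p.+1 -> 'I_q.+1) :
  (forall i : 'I_p.+1, nth (vertex ord0) w' i = nth (vertex ord0) w (a i)) ->
  aff q w \o simp_map a = aff p w'.
Proof.
move=> e; apply/funext => t; apply: simplex_inj; rewrite /= !affE.
under [RHS]eq_bigr do rewrite e.
rewrite (partition_big a xpredT) //=; apply: eq_bigr => j _.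
rewrite -[set_val (simp_map a t)]/(affmap a (set_val t)) mxE scaler_suml.
by apply: eq_bigr => i /eqP ->.
Qed.

Lemma aff_face {n} q (v : seq (simplex n)) (i : 'I_q.+2) :
  size v = q.+2 -> aff q.+1 v \o face i = aff q (omit i v).
Proof.
move=> sv; apply: aff_simp_map => j.
rewrite /omit nth_cat size_takel; last by rewrite sv ltnW.
rewrite /= /bump; case: (ltnP j i) => ji; first by rewrite nth_take.
by rewrite nth_drop addSn subnKC.
Qed.

Lemma map_aff_vertices {n} q (w : seq (simplex n)) :
  size w = q.+1 -> map (aff q w) (vertices q) = w.
Proof.
move=> sw; apply: (@eq_from_nth _ (vertex ord0)).
  by rewrite size_map size_vertices.
move=> i; rewrite size_map size_vertices => iq.
rewrite (nth_map (vertex ord0)) ?size_vertices //.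
rewrite (nth_vertices q _ (Ordinal iq)); apply: simplex_inj; rewrite affE.
rewrite (bigD1 (Ordinal iq)) //= mxE !eqxx scale1r big1 ?addr0 // => j ji.
by rewrite mxE (negbTE ji) andbF scale0r.
Qed.

Lemma continuous_set_val {X : topologicalType} (A : set X) :
  continuous (set_val : set_type A -> X).
Proof. exact: initial_continuous. Qed.

Lemma continuous_to_set_type {X Z : topologicalType} (A : set X)
    (h : Z -> set_type A) :
  continuous (set_val \o h) -> continuous h.
Proof. by move=> ch; apply: continuous_comp_initial. Qed.

Lemma aff_continuous {n} q (w : seq (simplex n)) : continuous (aff q w).
Proof.
apply: continuous_to_set_type => t.
apply: (@cvg_big 'rV[Rr]_n.+1 _ _ 0); first exact: add_continuous.
  exact: nbhs_filter.
move=> i _; apply: cvgZr_tmp; first exact: nbhs_filter.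
apply: (@continuous_comp (simplex q) 'rV[Rr]_q.+1 Rr set_val
  (fun x : 'rV[Rr]_q.+1 => x ord0 i) t).
  exact: (@continuous_set_val _ (Delta q)).
exact: coord_continuous.
Qed.

End Simplex.

(** * Mesh of the subdivision *)

Section Mesh.
Local Open Scope classical_set_scope.

Lemma In_nth {T : Type} (x0 : T) w i :
  (i < size w)%N -> List.In (nth x0 w i) w.
Proof.
elim: w i => // x w IH [|i] iw /=; first by left.
by right; apply: IH.
Qed.

Lemma nth_In {T : Type} (x0 : T) w x :
  List.In x w -> exists2 i, (i < size w)%N & x = nth x0 w i.
Proof.
elim: w => //= y w IH [->|/IH[i iw ->]]; first by exists 0%N.
by exists i.+1.
Qed.

(** Convexity of balls: [z] is the combination of copies of itself with the weights of [t]. *)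
Lemma aff_ball {n} q (w : seq (simplex n)) (t : simplex q) (z : 'rV[Rr]_n.+1) r :
  size w = q.+1 ->
  (forall x, List.In x w -> `|z - set_val x| <= r) ->
  `|z - set_val (aff q w t)| <= r.
Proof.
move=> sw wr.
rewrite affE -[z]scale1r -(simplex_sum1 t) scaler_suml -sumrB.
apply: le_trans (ler_norm_sum _ _ _) _.
rewrite -[leRHS]mul1r -(simplex_sum1 t) mulr_suml; apply: ler_sum => i _.
rewrite -scalerBr normrZ ger0_norm ?simplex_ge0 //.
by rewrite ler_wpM2l ?simplex_ge0 // wr //; apply: In_nth; rewrite sw.
Qed.

Lemma bary_ball {n} (v : seq (simplex n)) (z : 'rV[Rr]_n.+1) r :
  v <> [::] -> (forall x, List.In x v -> `|z - set_val x| <= r) ->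
  `|z - set_val (bary v)| <= r.
Proof. by move=> v0; apply: aff_ball; case: v v0. Qed.

Definition mesh {n} (d : Rr) (v : seq (simplex n)) :=
  forall x y, List.In x v -> List.In y v -> `|set_val x - set_val y| <= d.

(** With $q+1$ vertices the summand of [x] is zero and the other $q$ have weight $1/(q+1)$; moreover
    $q/(q+1)\le N/(N+1)$. *)
Lemma bary_dist {n} N d (v : seq (simplex n)) x :
  (size v <= N.+1)%N -> 0 <= d -> mesh d v -> List.In x v ->
  `|set_val x - set_val (bary v)| <= N%:R / N.+1%:R * d.
Proof.
move=> sv d0 md xv; have [j jv xE] := nth_In (vertex ord0) v x xv.
rewrite /bary; set q := (size v).-1.
have qE : size v = q.+1 by rewrite /q; case: (size v) jv.
rewrite qE in jv.
rewrite affE -[set_val x]scale1r -[X in X *: _](simplex_sum1 (center q)) scaler_suml -sumrB.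
under eq_bigr do rewrite -scalerBr mxE.
rewrite (bigD1 (Ordinal jv)) //= -xE subrr scaler0 add0r.
apply: le_trans (ler_norm_sum _ _ _) _.
apply: (@le_trans _ _ (\sum_(i < q.+1 | i != Ordinal jv) q.+1%:R^-1 * d)).
  apply: ler_sum => i _; rewrite normrZ ger0_norm ?invr_ge0 ?ler0n //.
  rewrite ler_wpM2l ?invr_ge0 ?ler0n // md //.
  by apply: In_nth; rewrite qE.
rewrite sumr_const cardC1 card_ord /= -[leLHS]mulr_natl mulrA ler_wpM2r //.
rewrite ler_pdivrMr ?ltr0n // mulrAC ler_pdivlMr ?ltr0n //.
by rewrite -!natrM ler_nat; move: sv; rewrite qE; nia.
Qed.

(** Pairs without the apex come from the subdivision of a face, where induction applies. Pairs with
    the apex are bounded by [bary_dist], since a ball around [bary v] that contains a face also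
    contains its subdivision. *)
Lemma sdsub_mesh {n} N d (v w : seq (simplex n)) :
  sdsub bary v w -> (size v <= N.+1)%N -> 0 <= d -> mesh d v ->
  mesh (N%:R / N.+1%:R * d) w.
Proof.
move=> sdvw; elim: sdvw => [|{}v i {}w iv sdvw IH] sv d0 md; first by move=> x y [].
have v0 : v <> [::] by move=> v0; rewrite v0 in iv.
have {}IH : mesh (N%:R / N.+1%:R * d) w.
  apply: IH => //; first by rewrite size_omit //; lia.
  move=> x y xo yo; apply: md.
    exact: (omit_sub (fun x => List.In x v) i v _ x xo).
  exact: (omit_sub (fun x => List.In x v) i v _ y yo).
have bw y : List.In y w -> `|set_val (bary v) - set_val y| <= N%:R / N.+1%:R * d.
  move=> yw.
  apply: (sdsub_closed bary (fun y => `|set_val (bary v) - set_val y|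
    <= N%:R / N.+1%:R * d) _ _ _ sdvw _ y yw) => [u u0 ur|u uo].
    exact: bary_ball.
  rewrite distrC; apply: bary_dist => //.
  exact: (omit_sub (fun x => List.In x v) i v _ u uo).
move=> x y /= [<-|xw] [<-|yw].
- by rewrite subrr normr0 mulr_ge0 // divr_ge0 ?ler0n.
- exact: bw.
- by rewrite distrC; exact: bw.
- exact: IH.
Qed.

Lemma iter_osd_vanish {R : comPzRingType} {n} N m d
    (phi : seq (simplex n) -> R) v :
  (size v <= N.+1)%N -> 0 <= d -> mesh d v ->
  (forall w, size w = size v -> mesh ((N%:R / N.+1%:R) ^+ m * d) w ->
    phi w = 0) ->
  iter m (osd bary) phi v = 0.
Proof.
elim: m d v => [|m IH] d v sv d0 md phi0.
  by apply: phi0 => //; rewrite expr0 mul1r.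
rewrite iterS; apply: osd_vanish => w vw.
have sw := sdsub_size _ _ _ vw.
apply: (IH (N%:R / N.+1%:R * d)) => //.
- by rewrite sw.
- by rewrite mulr_ge0 // divr_ge0 ?ler0n.
- exact: sdsub_mesh vw _ _ _.
- by move=> u su mu; apply: phi0; [rewrite su|rewrite exprSr -mulrA].
Qed.

Lemma seq_simplex_bounded {n} (v : seq (simplex n)) :
  exists2 d : Rr, 0 <= d & forall x, List.In x v -> `|set_val x| <= d.
Proof.
elim: v => [|x v [d d0 IH]]; first by exists 0.
exists (`|set_val x| + d); first by rewrite addr_ge0.
by move=> y /= [<-|/IH yd]; [rewrite lerDl|apply: ler_wpDl].
Qed.

Lemma mesh_exists {n} (v : seq (simplex n)) : exists2 d, 0 <= d & mesh d v.
Proof.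
have [d d0 vd] := seq_simplex_bounded v.
exists (d + d); first by rewrite addr_ge0.
by move=> x y xv yv; rewrite (le_trans (ler_normB _ _)) // lerD ?vd.
Qed.

Lemma Delta_compact n : compact (Delta n).
Proof.
apply: bounded_closed_compact.
  have [d d0 vd] := seq_simplex_bounded (vertices n).
  exists d; split; first exact: num_real.
  move=> e de t Dt; apply: le_trans (ltW de).
  (* Every point of the simplex is an affine combination of the vertices, so it lies in each ball
     around 0 containing them. *)
  have := aff_ball n (vertices n) (spoint t Dt) 0 d (size_vertices n).
  rewrite aff_vertices sub0r normrN; apply => x xv.
  by rewrite sub0r normrN; exact: vd.
have -> : Delta n =
    (\bigcap_i [set t : 'rV[Rr]_n.+1 | 0 <= t ord0 i]) `&`
    [set t : 'rV[Rr]_n.+1 | \sum_i t ord0 i = 1].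
  apply/seteqP; split=> t [t0 t1]; split=> // i; first by move=> _; exact: t0.
  exact: t0.
apply: closedI.
  apply: closed_bigI => i _.
  apply: (@preimage_closed _ _ (fun t : 'rV[Rr]_n.+1 => t ord0 i) [set x | 0 <= x]).
    by move=> t _; exact: coord_continuous.
  exact: closed_ge.
apply: (@preimage_closed _ _ (fun t : 'rV[Rr]_n.+1 => \sum_i t ord0 i) [set x | x = 1]).
  move=> t _; apply: (@cvg_big Rr _ _ 0); first exact: add_continuous.
    exact: nbhs_filter.
  by move=> i _; exact: coord_continuous.
exact: closed_eq.
Qed.

(** Near a given point one member of the cover serves for all small [e]; compactness makes [e]
    uniform. *)
Lemma simplex_Lebesgue_number {n} {X : topologicalType} {I : Type}
    (W : I -> set X) (s : simplex n -> X) :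
  continuous s -> (forall i, open (W i)) -> (forall x, exists i, W i x) ->
  exists2 e : Rr, 0 < e & forall z, Delta n z ->
    exists i, forall y : simplex n, `|z - set_val y| <= e -> W i (s y).
Proof.
move=> cs oW covW.
suff /filter_ex [e [e0 He]] : \forall e \near (0 : Rr)^'+, 0 < e /\
    Delta n `<=` [set z | exists i, forall y : simplex n,
      `|z - set_val y| <= e -> W i (s y)] by exists e.
near=> e; split; first by near: e; exact: nbhs_right_gt.
near: e.
move/compact_near_coveringP: (Delta_compact n); apply => z Dz.
have [i Wi] := covW (s (spoint z Dz)).
(* The preimage is the trace of an open set [B] of the ambient row space. *)
have [B oB BE] : open (s @^-1` W i) by exact: open_comp.
have /nbhs_ballP[r /= r0 rB] : nbhs z B.
  apply: open_nbhs_nbhs; split => //.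
  by rewrite -[B z]/((set_val @^-1` B) (spoint z Dz)) BE.
(* One half of the radius is for moving [z], the other for [e]. *)
exists (ball z (r / 2), [set e | e < r / 2]) => /=.
  split; first by apply: nbhsx_ballx; rewrite divr_gt0.
  by apply: nbhs_right_lt; rewrite divr_gt0.
move=> [z' e] /= [zz' er]; exists i => y ye.
suff : (s @^-1` W i) y by [].
rewrite -BE; apply: rB.
rewrite -ball_normE /= in zz' *.
rewrite -(subrK z' z) -addrA (le_lt_trans (ler_normD _ _)) //.
by rewrite [r]splitr ltrD // (le_lt_trans ye).
Unshelve. all: by end_near.
Qed.

End Mesh.

(** * Singular cochains as ordered cochains *)

Section Pull.
Context {R : comPzRingType}.
Local Open Scope classical_set_scope.

(* The restriction of [c] to the affine simplices of [s], which are given by their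
   sequences of vertices; the value 0 at [::] matches [tdelta] in degree 0. *)
Definition pull {X : topologicalType} {n} (s : simplex n -> X)
    (c : tcochain R X) (w : seq (simplex n)) : R :=
  if w is [::] then 0 else c (size w).-1 (s \o aff (size w).-1 w).

Section Fixed.
Context {X : topologicalType}.
Implicit Types a b c : tcochain R X.

Lemma pullE {n} (s : simplex n -> X) c q w :
  size w = q.+1 -> pull s c w = c q (s \o aff q w).
Proof. by case: w => // x w [<-]. Qed.

Lemma pull_vertices {n} (s : simplex n -> X) c : pull s c (vertices n) = c n s.
Proof. by rewrite (pullE _ _ n) ?size_vertices // aff_vertices. Qed.

Lemma pull_aff {n} (s : simplex n -> X) c q w v :
  pull (s \o aff q w) c v = pull s c (map (aff q w) v).
Proof.
case: v => // x v; rewrite (pullE _ _ (size v)) // (pullE s _ (size v)).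
  by rewrite aff_map.
by rewrite size_map.
Qed.

Lemma pull_odelta {n} (s : simplex n -> X) c w :
  pull s (tdelta c) w = odelta (pull s c) w.
Proof.
case: w => // x [|y w]; first by rewrite /= subr0.
set v := x :: y :: w; rewrite odeltaE (pullE _ _ (size w).+1) //.
rewrite [LHS]/(delta _ _) /delta; apply: eq_bigr => i _; congr (_ * _).
rewrite (pullE _ _ (size w)); last by rewrite size_omit //=; exact: ltn_ord.
congr (c _ _); rewrite -[_ \o face i]compA.
by rewrite aff_face.
Qed.

Lemma pull_cup {n} (s : simplex n -> X) a b w :
  pull s (cup a b) w = ocup (pull s a) (pull s b) w.
Proof.
case: w => // x w'; set w := x :: w'; rewrite ocupE (pullE _ _ (size w')) //.
rewrite [LHS]/cup; apply: eq_bigr => p _.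
have pw : (p < size w)%N by exact: ltn_ord.
rewrite (pullE _ _ p); last by rewrite size_takel.
rewrite (pullE _ _ (size w' - p)); last by rewrite size_drop /= subSn // -ltnS.
congr (_ * _).
  congr (a _ _); rewrite -[_ \o frontmap _ _]compA.
  rewrite (aff_simp_map _ _ _ (take p.+1 w)) // => i.
  rewrite nth_take // inordK //; have := ltn_ord i; have := ltn_ord p.
  rewrite /=; lia.
congr (b _ _); rewrite -[_ \o backmap _ _]compA.
rewrite (aff_simp_map _ _ _ (drop p w)) // => i.
rewrite nth_drop inordK //; have := ltn_ord i; have := ltn_ord p.
rewrite /=; lia.
Qed.

Lemma pull_vanish {n} (s : simplex n -> X) c (P : set X) :
  continuous s -> (forall x, P (s x)) ->
  (forall q (t : simplex q -> X), continuous t -> (forall x, P (t x)) ->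
    c q t = 0) ->
  forall w, pull s c w = 0.
Proof.
move=> cs Ps c0 [//|x w]; rewrite (pullE _ _ (size w)) //.
apply: c0 => [t|t]; last exact: Ps.
by apply: continuous_comp; [exact: aff_continuous|exact: cs].
Qed.

Lemma pull_tdelta_vanish {n} (s : simplex n -> X) c :
  continuous s -> cocycle c -> forall w, pull s (tdelta c) w = 0.
Proof.
move=> cs cc; apply: (pull_vanish s _ setT cs) => // -[|q] t ct _ //.
exact: cc.
Qed.

End Fixed.
End Pull.

(** * Cup products in cohomology *)

Section CupProduct.
Context {R : comPzRingType} {X : topologicalType}.
Implicit Types a b c : tcochain R X.

Definition tsign c : tcochain R X := fun n s => (-1) ^+ n * c n s.

Lemma pull_tsign {n} (s : simplex n -> X) c :
  pull s (tsign c) =1 osign (pull s c).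
Proof.
case=> [|x w]; first by rewrite /osign /= mulr0.
by rewrite /osign (pullE _ _ (size w)) // /= 2!exprS !mulN1r opprK.
Qed.

(** This is [ocup_Leibniz] on the vertices of the standard simplex; the augmentation terms vanish
    since [pull] is 0 at [[::]]. *)
Lemma tdelta_cup a b n (s : simplex n -> X) :
  tdelta (cup a b) n s = cup (tdelta a) b n s + cup (tsign a) (tdelta b) n s.
Proof.
rewrite -!pull_vertices pull_odelta !pull_cup.
rewrite (eq_odelta _ (ocup (pull s a) (pull s b))); last first.
  by move=> i _; exact: pull_cup.
have := ocup_Leibniz (pull s a) (pull s b) (vertices n).
rewrite /= mulr0 mul0r !addr0 => <-; congr (_ + _).
  by apply: eq_ocup => // w; rewrite pull_odelta.
by apply: eq_ocup => w; rewrite ?pull_odelta // pull_tsign.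
Qed.

Lemma tdelta_tdelta c n (s : simplex n -> X) : tdelta (tdelta c) n s = 0.
Proof.
rewrite -pull_vertices pull_odelta -[RHS](odelta_odelta (pull s c) (vertices n)).
by apply: eq_odelta => i _; rewrite pull_odelta.
Qed.

Lemma tdeltaD a b n (s : simplex n -> X) :
  tdelta (fun m t => a m t + b m t) n s = tdelta a n s + tdelta b n s.
Proof.
case: n s => [|n] s /=; first by rewrite addr0.
by rewrite -big_split; apply: eq_bigr => i _; rewrite mulrDr.
Qed.

Lemma tdeltaB a b n (s : simplex n -> X) :
  tdelta (tsub a b) n s = tdelta a n s - tdelta b n s.
Proof.
case: n s => [|n] s /=; first by rewrite subr0.
by rewrite -sumrB; apply: eq_bigr => i _; rewrite mulrBr.
Qed.

Lemma tdelta_tsign c n (s : simplex n -> X) :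
  tdelta (tsign c) n s = - tsign (tdelta c) n s.
Proof.
case: n s => [|n] s /=; first by rewrite /tsign /= mulr0 oppr0.
rewrite /tsign /= /delta mulr_sumr -sumrN; apply: eq_bigr => i _.
by rewrite mulrCA exprS !mulN1r !mulNr opprK.
Qed.

Lemma cocycle_tdelta c n (s : simplex n -> X) :
  cocycle c -> continuous s -> tdelta c n s = 0.
Proof. by case: n s => // n s cc cs; exact: cc. Qed.

Lemma cocycle_tsign c : cocycle c -> cocycle (tsign c).
Proof.
by move=> cc n s cs; rewrite tdelta_tsign /tsign cocycle_tdelta // mulr0 oppr0.
Qed.

Lemma cup_vanishl {n} (s : simplex n -> X) a b :
  (forall w, pull s a w = 0) -> cup a b n s = 0.
Proof.
by move=> a0; rewrite -pull_vertices pull_cup; apply: ocup0l => w.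
Qed.

Lemma cup_vanishr {n} (s : simplex n -> X) a b :
  (forall w, pull s b w = 0) -> cup a b n s = 0.
Proof.
by move=> b0; rewrite -pull_vertices pull_cup; apply: ocup0r => w.
Qed.

Lemma cocycle_cup a b : cocycle a -> cocycle b -> cocycle (cup a b).
Proof.
move=> ca cb n s cs; rewrite tdelta_cup.
rewrite cup_vanishl ?cup_vanishr ?addr0 // => w; exact: pull_tdelta_vanish.
Qed.

Lemma coboundary_cupl a b : coboundary a -> cocycle b -> coboundary (cup a b).
Proof.
move=> [x ax] cb; exists (cup x b) => n s cs.
rewrite tdelta_cup [X in _ + X]cup_vanishr; last exact: pull_tdelta_vanish.
rewrite addr0 -!pull_vertices !pull_cup; apply: eq_ocup => // w.
case: w => // y w; rewrite !(pullE _ _ (size w)) // ax // => t.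
by apply: continuous_comp; [exact: aff_continuous|exact: cs].
Qed.

Lemma coboundary_cupr a b : cocycle a -> coboundary b -> coboundary (cup a b).
Proof.
(* The sign in the witness cancels the one from the Leibniz rule. *)
move=> ca [x bx]; exists (cup (tsign a) x) => n s cs.
rewrite tdelta_cup [X in X + _]cup_vanishl; last first.
  by apply: pull_tdelta_vanish => //; exact: cocycle_tsign.
rewrite add0r -!pull_vertices !pull_cup; apply: eq_ocup => w.
  case: w => // y w; rewrite !(pullE _ _ (size w)) // /tsign mulrA -expr2.
  by rewrite sqrr_sign mul1r.
case: w => // y w; rewrite !(pullE _ _ (size w)) // bx // => t.
by apply: continuous_comp; [exact: aff_continuous|exact: cs].
Qed.

(** $ab-a'b'=(a-a')b+a'(b-b')$. *)
Lemma cohomologous_cup a a' b b' :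
  cocycle a' -> cocycle b -> cohomologous a a' -> cohomologous b b' ->
  cohomologous (cup a b) (cup a' b').
Proof.
move=> ca' cb aa' bb'.
have [x ex] := coboundary_cupl _ _ aa' cb.
have [y ey] := coboundary_cupr _ _ ca' bb'.
exists (fun m t => x m t + y m t) => n s cs; rewrite tdeltaD -ex // -ey //.
rewrite /tsub -!pull_vertices !pull_cup.
have -> : pull s (fun m (t : simplex m -> X) => a m t - a' m t) =
    fun z => pull s a z - pull s a' z by apply/funext => -[|z w] /=; rewrite ?subrr.
have -> : pull s (fun m (t : simplex m -> X) => b m t - b' m t) =
    fun z => pull s b z - pull s b' z by apply/funext => -[|z w] /=; rewrite ?subrr.
by rewrite ocupBl ocupBr addrA subrK.
Qed.

Lemma cupn_cocycle (u : nat -> tcochain R X) k :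
  (forall j, (j <= k)%N -> cocycle (u j)) -> cocycle (cupn u k).
Proof.
elim: k => [|k IH] cu /=; first exact: cu.
by apply: cocycle_cup; [apply: IH => j jk; apply: cu; exact: leqW|exact: cu].
Qed.

Lemma cohomologous_cupn (u u' : nat -> tcochain R X) k :
  (forall j, (j <= k)%N -> cocycle (u j)) ->
  (forall j, (j <= k)%N -> cocycle (u' j)) ->
  (forall j, (j <= k)%N -> cohomologous (u j) (u' j)) ->
  cohomologous (cupn u k) (cupn u' k).
Proof.
elim: k => [|k IH] cu cu' uu' /=; first exact: uu'.
apply: cohomologous_cup.
- by apply: cupn_cocycle => j jk; apply: cu'; exact: leqW.
- exact: cu.
- by apply: IH => j jk; [apply: cu|apply: cu'|apply: uu']; exact: leqW.
- exact: uu'.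
Qed.

End CupProduct.

(** * Cocycles vanishing on small simplices *)

Section SmallSimplices.
Context {R : comPzRingType} {X : topologicalType} {I : Type}.
Local Open Scope classical_set_scope.
Context (W : I -> set X) (c : tcochain R X).
Hypothesis W_open : forall i, open (W i).
Hypothesis W_cover : forall x, exists i, W i x.
Hypothesis c_cocycle : cocycle c.
Hypothesis c_small : forall i n (s : simplex n -> X), continuous s ->
  (forall x, W i (s x)) -> c n s = 0.

(** The Lebesgue number at the first vertex gives one [W i] containing the image of a whole ball. By
    convexity this ball contains all points that occur in [oht]. *)
Lemma pull_small {n} (s : simplex n -> X) : continuous s ->
  exists2 r : Rr, 0 < r & forall w, mesh r w ->
    pull s c w = 0 /\ oht bary (pull s c) w = 0.
Proof.
move=> cs; have [r r0 rW] := simplex_Lebesgue_number W s cs W_open W_cover.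
exists r => // -[|z w] mw; first by split.
have ball0 v : (forall y, List.In y v -> `|set_val z - set_val y| <= r) ->
    pull s c v = 0.
  have [i iW] := rW _ (set_valP z).
  case: v => // y v vr; rewrite (pullE _ _ (size v)) //; apply: (c_small i).
    by move=> t; apply: continuous_comp; [exact: aff_continuous|exact: cs].
  by move=> t; apply: iW; exact: aff_ball.
have zw y : List.In y (z :: w) -> `|set_val z - set_val y| <= r.
  by move=> yw; apply: mw => //; left.
split; first exact: ball0.
apply: (oht_vanish bary (fun y => `|set_val z - set_val y| <= r)) => // v v0 vr.
exact: bary_ball.
Qed.

Lemma expr_small (N : nat) (d r : Rr) : 0 <= d -> 0 < r ->
  exists M, forall i, (M <= i)%N -> (N%:R / N.+1%:R) ^+ i * d <= r.
Proof.
move=> d0 r0; set l : Rr := N%:R / N.+1%:R.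
have l0 : 0 <= l by rewrite divr_ge0 ?ler0n.
have l1 : `|l| < 1 by rewrite ger0_norm // ltr_pdivrMr ?ltr0n // mul1r ltr_nat.
(* Dividing by [d + 1] also covers the case [d = 0]. *)
have d1 : 0 < d + 1 by rewrite ltr_wpDl.
have /cvgrPdist_lt /(_ (r / (d + 1))) := cvg_expr l1.
move=> /(_ (divr_gt0 r0 d1)) [M _ MP]; exists M => i Mi.
have := MP i Mi; rewrite /= sub0r normrN ger0_norm ?exprn_ge0 // => /ltW li.
rewrite (@le_trans _ _ (l ^+ i * (d + 1))) //.
  by rewrite ler_wpM2l ?exprn_ge0 // lerDl.
by rewrite -ler_pdivlMr.
Qed.

Definition sdterm n (s : simplex n -> X) i : R :=
  iter i (osd bary) (oht bary (pull s c)) (vertices n).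

(** Each subdivision shrinks the mesh bound by the factor $n/(n+1)$, so it eventually falls below
    the [r] of [pull_small]. *)
Lemma sd_eventually0 n (s : simplex n -> X) : continuous s ->
  exists M, forall i, (M <= i)%N ->
    iter i (osd bary) (pull s c) (vertices n) = 0 /\ sdterm n s i = 0.
Proof.
move=> cs; have [r r0 small0] := pull_small s cs.
have [d d0 md] := mesh_exists (vertices n).
have [M MP] := expr_small n d r d0 r0.
exists M => i Mi.
have small w : mesh ((n%:R / n.+1%:R) ^+ i * d) w -> mesh r w.
  by move=> mw x y xw yw; apply: le_trans (mw x y xw yw) _; exact: MP.
by split; apply: (iter_osd_vanish n i d) => //;
  rewrite ?size_vertices // => w _ /small/small0[].
Qed.

(** The bound has to be a function on all maps, as cochains are; its values at non-continuous maps
    are arbitrary. *)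
Lemma sdterm_bound n : exists M : (simplex n -> X) -> nat,
  forall s, continuous s -> forall i, (M s <= i)%N -> sdterm n s i = 0.
Proof.
have /choice[M MP] : forall s : simplex n -> X, exists M : nat,
    continuous s -> forall i, (M <= i)%N -> sdterm n s i = 0.
  move=> s; case: (pselect (continuous s)) => [cs|ncs]; last by exists 0%N.
  have [M MP] := sd_eventually0 n s cs.
  by exists M => _ i /MP[].
by exists M.
Qed.

Lemma sum_eventually0 (F : nat -> R) m M : (m <= M)%N ->
  (forall i, (m <= i)%N -> F i = 0) -> \sum_(i < M) F i = \sum_(i < m) F i.
Proof.
move=> mM F0; rewrite -!(big_mkord xpredT F) (@big_cat_nat _ _ _ m) //=.
by rewrite [X in _ + X]big_nat [X in _ + X]big1 ?addr0 // => i /andP[mi _]; exact: F0.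
Qed.

(* The terms of sum_i sd^i(T c) vanish from some [i] on, depending on the simplex,
   and [osd_telescope] shows that this sum is a primitive of [c]. *)
Lemma small_cocycle_coboundary : coboundary c.
Proof.
pose M n := projT1 (cid (sdterm_bound n)).
have MP n : forall s : simplex n -> X, continuous s ->
  forall i, (M n s <= i)%N -> sdterm n s i = 0 := projT2 (cid (sdterm_bound n)).
exists (fun n s => \sum_(i < M n s) sdterm n s i) => -[|n] s cs.
  (* In degree 0 the image is a single point and lies in some [W i]. *)
  have [i Wi] := W_cover (s (vertex ord0)).
  apply: (c_small i) => // x; rewrite (_ : x = vertex ord0) //.
  apply: simplex_inj; apply/rowP => j; rewrite [j]ord1.
  have := simplex_sum1 x; rewrite big_ord1 => ->.
  by have := simplex_sum1 (vertex (@ord0 0)); rewrite big_ord1.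
have faceE j : s \o face j = s \o aff n (omit j (vertices n.+1)).
  by rewrite -aff_face ?size_vertices // aff_vertices.
have cface (j : 'I_n.+2) : continuous (s \o face j).
  rewrite faceE => t.
  by apply: continuous_comp; [exact: aff_continuous|exact: cs].
have [M0 M0P] := sd_eventually0 n.+1 s cs.
(* Large enough for the [N]-fold subdivision of [c] to vanish on [s], and at least the bound of
   every face of [s]. *)
pose N := maxn M0 (\max_(j < n.+2) M n (s \o face j)).
rewrite -[LHS]pull_vertices -[LHS]subr0.
rewrite -[X in _ - X](proj1 (M0P N (leq_maxl _ _))) osd_telescope; last first.
  by move=> w; rewrite -pull_odelta; exact: pull_tdelta_vanish.
rewrite odeltaE size_vertices [RHS]/(delta _ _); apply: eq_bigr => j _.
congr (_ * _).
rewrite -(sum_eventually0 (sdterm n (s \o face j)) (M n (s \o face j)) N).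
(* By naturality, subdividing a face as a standard simplex amounts to subdividing its vertex
   sequence inside the larger simplex. *)
- apply: eq_bigr => i _; rewrite /sdterm faceE.
  rewrite (_ : pull _ c = fun v => pull s c
      (map (aff n (omit j (vertices n.+1))) v)); last first.
    by apply/funext => v; exact: pull_aff.
  have bm := bary_map n (omit j (vertices n.+1)).
  rewrite (_ : oht _ _ = fun v => oht bary (pull s c)
      (map (aff n (omit j (vertices n.+1))) v)); last first.
    by apply/funext => v; exact: (oht_map bary bary _ bm).
  rewrite (iter_osd_map bary bary _ bm) map_aff_vertices //.
  by rewrite size_omit ?size_vertices.
- by rewrite leq_max (leq_bigmax j) orbT.
- by move=> i; exact: MP.
Qed.

End SmallSimplices.

(** * Relative cup products and homotopic distance *)

Section RelativeCup.
Context {R : comPzRingType} {X : topologicalType}.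
Local Open Scope classical_set_scope.

(** A primitive on [U] is extended by zero to the simplices that leave [U]. The faces of a simplex
    in [U] stay in [U], so its coboundary there is unchanged. *)
Lemma coboundary_extend (c : tcochain R X) (U : set X) :
  coboundary (pb (set_val : set_type U -> X) c) ->
  exists b : tcochain R X, forall n (s : simplex n -> X), continuous s ->
    (forall x, U (s x)) -> c n s = tdelta b n s.
Proof.
move=> [b cb].
pose lift_to n (s : simplex n -> X) (Us : forall x, U (s x)) : simplex n -> set_type U :=
  fun x => @exist _ (fun y => y \in U) (s x) (mem_set (Us x)).
exists (fun n s => if pselect (forall x, U (s x)) is left Us
                   then b n (lift_to n s Us) else 0).
move=> n s cs Us.
have cl : continuous (lift_to n s Us) by exact: continuous_to_set_type.
have -> : c n s = pb (set_val : set_type U -> X) c n (lift_to n s Us).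
  by congr (c n _); apply/funext.
rewrite cb //; case: n s cs Us {cl} => // n s cs Us /=.
rewrite /delta; apply: eq_bigr => i _; congr (_ * _).
case: pselect => [Uf|[]]; last by move=> x; exact: Us.
by congr (b n _); apply/funext => x; apply: val_inj.
Qed.

Lemma cupn_coboundary (u : nat -> tcochain R X) k (W : nat -> set X) :
  (forall j, open (W j)) -> (forall x, exists2 j, (j <= k)%N & W j x) ->
  (forall j, (j <= k)%N -> cocycle (u j)) ->
  (forall j, (j <= k)%N -> coboundary (pb (set_val : set_type (W j) -> X) (u j))) ->
  coboundary (cupn u k).
Proof.
move=> oW covW cu ub.
have /choice[b bP] : forall j, exists b : tcochain R X, (j <= k)%N ->
    forall n (s : simplex n -> X), continuous s ->
    (forall x, W j (s x)) -> u j n s = tdelta b n s.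
  move=> j; have [jk|jk] := boolP (j <= k)%N; last by exists (u j).
  by have [b bP] := coboundary_extend _ _ (ub j jk); exists b.
(* A representative of the class of [u j] that vanishes on the simplices in [W j]. *)
pose u' j := tsub (u j) (tdelta (b j)).
have cu' j : (j <= k)%N -> cocycle (u' j).
  by move=> jk n s cs; rewrite tdeltaB tdelta_tdelta subr0; exact: cu.
have uu' j : (j <= k)%N -> cohomologous (u j) (u' j).
  by move=> jk; exists (b j) => n s cs; rewrite /tsub subKr.
have vanish m : (m <= k)%N -> forall j, (j <= m)%N -> forall n (s : simplex n -> X),
    continuous s -> (forall x, W j (s x)) -> cupn u' m n s = 0.
  have u'0 j : (j <= k)%N -> forall n (s : simplex n -> X),
      continuous s -> (forall x, W j (s x)) -> u' j n s = 0.
    by move=> jk n s cs Ws; rewrite /u' /tsub (bP j jk) ?subrr.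
  elim: m => [|m IH] mk j; first by rewrite leqn0 => /eqP ->; exact: u'0.
  (* A product vanishes on a simplex if one factor vanishes on all its affine subsimplices: the last
     factor for [j = m.+1], otherwise the product of the earlier ones. *)
  rewrite leq_eqVlt => /predU1P[->|jm] n s cs Ws /=.
    by apply: cup_vanishr; apply: (pull_vanish s _ (W m.+1)) => //; exact: u'0.
  apply: cup_vanishl; apply: (pull_vanish s _ (W j)) => //.
  by apply: IH => //; exact: ltnW.
have [x ex] := cohomologous_cupn _ _ _ cu cu' uu'.
have [y ey] : coboundary (cupn u' k).
  apply: (small_cocycle_coboundary (fun j : 'I_k.+1 => W j)) => //.
  - by move=> z; have [j jk Wj] := covW z; exists (Ordinal (jk : (j < k.+1)%N)).
  - exact: cupn_cocycle.
  - by move=> j; apply: vanish => //; rewrite -ltnS.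
exists (fun m t => x m t + y m t) => n s cs.
by rewrite tdeltaD -ex // -ey // /tsub subrK.
Qed.

End RelativeCup.

Section HomotopicDistance.
Context {X Y : topologicalType}.
Local Open Scope classical_set_scope.

Lemma homotopic_on_comp {A : topologicalType} (phi : A -> X) (U : set X)
    (f g : X -> Y) : continuous phi -> homotopic_on U f g ->
  homotopic_on (phi @^-1` U) (f \o phi) (g \o phi).
Proof.
move=> cphi [H [cH HP]]; exists (fun p => H (phi p.1, p.2)); split; last first.
  by move=> x Ux; exact: HP.
have cHP := (@subspace_continuousP _ _ _ _).1 cH.
apply/subspace_continuousP => -[a t] [/= Ua t01].
have := cHP (phi a, t) (conj Ua t01); apply: cvg_trans => /= Q.
rewrite /= /fmap /= !nbhs_simpl /within /= => -[[B C] [/= nB nC] BCQ].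
exists (phi @^-1` B, C) => /=; first by split=> //; exact: cphi.
by move=> [a' t'] [/= Ba Ct] [/= Ua' t01']; apply: (BCQ (phi a', t')).
Qed.

Lemma homotopic_on_set0 (f g : X -> Y) : homotopic_on set0 f g.
Proof.
exists (f \o fst); split => //.
by rewrite set0X; exact: continuous_subspace0.
Qed.

Lemma Dist_le (f g : X -> Y) n k : D_cover f g n -> (n <= k)%N ->
  (Dist f g <= (k%:R : Rr)%:E)%E.
Proof.
move=> Dn nk; apply: (@le_trans _ _ ((n%:R : Rr)%:E)).
  by apply: ereal_inf_lbound; exists n.
by rewrite lee_fin ler_nat.
Qed.

End HomotopicDistance.

(** * Homotopy weight *)

Section HomotopyWeight.
Context {R : comPzRingType} {X Y : topologicalType} (f g : X -> Y).
Local Open Scope classical_set_scope.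
Implicit Types u : tcochain R X.

(* [hw f g u >= m], phrased so that it makes sense for all [m : nat] and
   holds for every [m] when [u] is a coboundary. *)
Definition hw_atleast u (m : nat) : Prop :=
  forall (A : topologicalType) (phi : A -> X), continuous phi ->
  forall m', m = m'.+1 -> D_cover (f \o phi) (g \o phi) m' ->
  coboundary (pb phi u).

Lemma coboundary_pb {A : topologicalType} (phi : A -> X) u :
  continuous phi -> coboundary u -> coboundary (pb phi u).
Proof.
move=> cphi [b ub]; exists (pb phi b) => n s cs.
transitivity (tdelta b n (phi \o s)); last by case: n s cs.
by apply: ub => t; apply: continuous_comp; [exact: cs|exact: cphi].
Qed.

(** An index [k >= m] in the supremum would give [hw_atleast u m.+1], since a cover by [m.+1] sets
    bounds the distance by [m], hence by [k]. *)
Lemma hw_le u m : ~ hw_atleast u m.+1 -> (hw f g u <= (m%:R : Rr)%:E)%E.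
Proof.
move=> nu; rewrite /hw; case: pselect => [cu|ncu] /=.
  by case: nu => A phi cphi m' _ _; exact: coboundary_pb.
apply: ge_ereal_sup => _ [->|[k hk <-]]; first by rewrite lee_fin ler0n.
rewrite lee_fin ler_nat leqNgt; apply/negP => mk; apply: nu.
move=> A phi cphi m' [<-] Dm; apply: hk => //; exact: Dist_le Dm _.
Qed.

(** A natural number in place of $\min(\mathrm{hw},n)$: weights may be infinite, whereas blocks of a
    finite cover need finite sizes. *)
Lemma hw_truncation u n : exists2 m, hw_atleast u m &
  m = n \/ (hw f g u <= (m%:R : Rr)%:E)%E.
Proof.
elim: n => [|n [m um [mn|um']]].
- by exists 0%N; [|left].
- have [un|un] := pselect (hw_atleast u n.+1); first by exists n.+1; [|left].
  by exists n; [rewrite -mn|right; exact: hw_le].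
- by exists m; [|right].
Qed.

Lemma partial_sum_block (m : nat -> nat) i k : (i < \sum_(j < k) m j)%N ->
  exists2 j, (j < k)%N & (\sum_(l < j) m l <= i < \sum_(l < j) m l + m j)%N.
Proof.
elim: k => [|k IH]; first by rewrite big_ord0.
have [/IH[j jk ji] _|ki] := ltnP i (\sum_(j < k) m j).
  by exists j => //; exact: ltnW.
by rewrite big_ord_recr /= => ik; exists k => //; rewrite ki.
Qed.

Lemma cupn_coboundary_hw (u : nat -> tcochain R X) k n (m : nat -> nat) :
  (forall j, (j <= k)%N -> cocycle (u j)) ->
  (forall j, hw_atleast (u j) (m j)) ->
  D_cover f g n -> (n < \sum_(j < k.+1) m j)%N ->
  coboundary (cupn u k).
Proof.
move=> cu um [U [oU [covU hU]]] nm.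
(* The block sizes may add up to more than [n.+1], so the cover is continued by empty sets. *)
pose V i := if (i <= n)%N then U (inord i) else set0.
have oV i : open (V i) by rewrite /V; case: ifP => // _; exact: open0.
have hV i : homotopic_on (V i) f g.
  by rewrite /V; case: ifP => // _; exact: homotopic_on_set0.
pose a j := (\sum_(l < j) m l)%N.
pose W j := \bigcup_(i in [set i | (i < m j)%N]) V (a j + i)%N.
apply: (cupn_coboundary u k W) => //.
- by move=> j; apply: bigcup_open.
- move=> x; have [i _ Uix] : (\bigcup_j U j) x by rewrite covU.
  have [j jk /andP[ai ia]] : exists2 j, (j < k.+1)%N &
      (a j <= i < a j + m j)%N.
    by apply: partial_sum_block; apply: leq_trans nm; exact: ltn_ord.
  exists j => //; exists (i - a j)%N => /=; first by rewrite ltn_subLR.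
  by rewrite subnKC // /V -ltnS ltn_ord inord_val.
(* A block of size 0 gives an empty [W j], into which no simplex maps. *)
- move=> j jk; have [m0|[m' mE]] : m j = 0%N \/ exists m', m j = m'.+1.
    by case: (m j) => [|m']; [left|right; exists m'].
    exists (fun _ _ => 0) => q s _; have [i /=] := set_valP (s (vertex ord0)).
    by rewrite m0.
  apply: (um j _ _ (continuous_set_val (W j)) m' mE).
  (* The members of the block, traced on [W j], form the cover that [hw_atleast] asks for. *)
  exists (fun i : 'I_m'.+1 => set_val @^-1` V (a j + i)%N); split.
    move=> i; apply: open_comp => // x _; exact: continuous_set_val.
  split; last first.
    by move=> i; apply: homotopic_on_comp => //; exact: continuous_set_val.
  apply/seteqP; split => // x _; have [i /= im Vi] := set_valP x.
  by rewrite mE in im; exists (Ordinal im).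
Qed.

End HomotopyWeight.

Theorem theorem5p10 (R : comPzRingType) (X Y : topologicalType) (f g : X -> Y)
  (cf : continuous f) (cg : continuous g)
  (k : nat) (u : nat -> tcochain R X) :
  (forall j, (j <= k)%N -> is_class (u j) /\ in_J f g (u j)) ->
  ~ coboundary (cupn u k) ->
  (\sum_(j < k.+1) hw f g (u j) <= Dist f g)%E.
Proof.
move=> uP ncup; apply: le_ereal_inf_tmp => _ [n Dn <-].
have /choice[m /all_and2[um mP]] : forall j, exists m,
    hw_atleast f g (u j) m /\
    (m = n.+1 \/ (hw f g (u j) <= (m%:R : Rr)%:E)%E).
  by move=> j; have [m um mP] := hw_truncation f g (u j) n.+1; exists m.
have mn : (\sum_(j < k.+1) m j <= n)%N.
  rewrite leqNgt; apply/negP => nm; apply: ncup.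
  apply: (cupn_coboundary_hw f g u k n m) => // j jk.
  by have [[]] := uP j jk.
apply: (@le_trans _ _ (\sum_(j < k.+1) ((m j)%:R : Rr)%:E)%E).
  (* If the truncation were reached, [m j = n.+1] alone would violate [mn]; hence [m j] bounds the
     weight. *)
  apply: lee_sum => j _; case: (mP j) => // mj.
  move: mn; rewrite (bigD1 j) //= mj; lia.
by rewrite sumEFin lee_fin -natr_sum ler_nat.
Qed.
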